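(* Let $G$ be a group and let $\sigma_G$ be any spectrum of $G$, endowed with the coarse lower topology. Then $\sigma_G$ is a $T_0$-space.
   Context: For a group $G$, $\mathrm{N}_G$ denotes the set of all normal subgroups of $G$. A spectrum $\sigma_G$ of $G$ is the set of all normal subgroups of $G$ having some fixed property (e.g. being prime, maximal, primary, principal, finitely generated, proper, ...), with the standing assumption $G\notin\sigma_G$; so it is a set of proper normal subgroups of $G$. For $\mathfrak{x}\in \mathrm{N}_G$ put $\mathcal{V}(\mathfrak{x})=\{\mathfrak{n}\in\sigma_G\mid \mathfrak{x}\subseteq\mathfrak{n}\}$. The coarse lower topology on $\sigma_G$ is the topology for which the sets $\mathcal{V}(\mathfrak{x})$, $\mathfrak{x}\in \mathrm{N}_G$, form a subbasis of closed sets. A spectrum with this topology is called a normal structure space. *)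

(* Defs.v *)
From HB Require Import structures.
From mathcomp Require Import all_boot all_classical all_analysis.

Set Implicit Arguments.
Unset Strict Implicit.
Unset Printing Implicit Defensive.

Local Open Scope classical_set_scope.
Local Open Scope group_scope.

Definition normal_subgroups (G : groupType) : set (set G) :=
  [set N | group_closed [in N] /\ forall x y, x \in N -> x ^ y \in N].

(* The property that singles out the members of a spectrum is an arbitrary
   predicate on normal subgroups, so a spectrum is any set of normal subgroups
   that does not contain the whole group. *)
Record spectrum (G : groupType) := Spectrum {
  spectrum_set :> set (set G);
  spectrum_normal : spectrum_set `<=` @normal_subgroups G;
  spectrum_proper : ~ spectrum_set setT
}.

(* The points of sigma, under an alias of the subtype so that the topology
   below is the only one inferred on it. *)
Definition structure_space (G : groupType) (sigma : spectrum G) : Type :=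
  set_type (spectrum_set sigma).

HB.instance Definition _ (G : groupType) (sigma : spectrum G) :=
  Choice.copy (structure_space sigma) (set_type (spectrum_set sigma)).

Definition hull (G : groupType) (sigma : spectrum G) (x : set G) :
    set (structure_space sigma) :=
  [set n | x `<=` val n].

(* Coarse lower topology: the hulls of the normal subgroups form a subbasis of
   closed sets, i.e., their complements form a subbasis of open sets. *)
HB.instance Definition _ (G : groupType) (sigma : spectrum G) :=
  @isSubBaseTopological.Build (structure_space sigma)
    (set G) (@normal_subgroups G) (fun x => ~` hull x).

(* Main.v *)
Require Import Defs.
From mathcomp Require Import all_boot all_classical all_analysis.

(** Each point of a spectrum is itself a normal subgroup, so its hull is a
    subbasic closed set.  If every neighbourhood of [n] contains [m], then the
    complement of the hull of [m], which omits [m], cannot be a neighbourhood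
    of [n]: thus [n] lies in the hull of [m], that is, [m] is included in [n].
    Two points with the same neighbourhoods are therefore included in each
    other, hence equal. *)

Local Open Scope classical_set_scope.

(** By definition of the coarse lower topology; normality of [N] is what puts
    its hull in the subbasis. *)
Lemma closed_hull (G : groupType) (sigma : spectrum G) (N : set G) :
  normal_subgroups N -> closed (@hull G sigma N).
Proof.
move=> normN; rewrite -openC.
(* An open set is a union of finite intersections of subbasic sets: here one
   intersection, indexed by the singleton of [N]. *)
exists [set ~` hull N]; last by rewrite bigcup_set1.
by move=> _ ->; apply: finI_from1.
Qed.

Lemma not_hull_separated (G : groupType) (sigma : spectrum G)
    (m n : structure_space sigma) :
  ~ hull (val m) n -> exists A, A \in nbhs n /\ m \in ~` A.
Proof.
move=> nhull; exists (~` hull (val m)); split; apply/mem_set.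
  apply: open_nbhs_nbhs; split=> //; rewrite openC; apply: closed_hull.
  exact/(spectrum_normal (s := sigma))/set_valP.
by rewrite setCK.
Qed.

Theorem theorem3p10 (G : groupType) (sigma : spectrum G) :
  kolmogorov_space (structure_space sigma).
Proof.
move=> m n /eqP neq_mn.
have [sub_mn|/not_hull_separated[A sepA]] :=
    pselect (hull (val m) n); last by exists A; right.
have [sub_nm|/not_hull_separated[A sepA]] :=
    pselect (hull (val n) m); last by exists A; left.
by case: neq_mn; apply/val_inj/seteqP.
Qed.
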